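(* For every $\epsilon > 0$ there exists $d_0 = d_0(\epsilon)$, depending only on $\epsilon$, such that for every integer $\tau \ge 1$ that is fixed with respect to $n$ and every $d \ge d_0$, $$\mathbb{P}\left[\alpha^{\tau}(\mathcal{G}_{n,d}) \le (2+\epsilon)\frac{\log d}{d}\right] \to 1 \quad \text{as } n \to \infty .$$
   Context: A subset $S$ of the vertex set $V(G)$ of a finite graph $G$ is a percolation set with clusters of size at most $\tau$ if all connected components of the induced subgraph $G[S]$ have at most $\tau$ vertices. Define $$\alpha^{\tau}(G) = \max\left\{ \frac{|S|}{|V(G)|} : S \subset V(G) \text{ is a percolation set with clusters of size at most } \tau\right\}.$$ $\mathcal{G}_{n,d}$ denotes the random $d$-regular multigraph on $n$ labelled vertices given by the configuration model: $nd$ is assumed even, each of the $n$ vertices emits $d$ distinct half-edges, the $nd$ half-edges are paired uniformly at random, and each pair is glued into an edge; loops and multiple edges are allowed. $\log$ is the natural logarithm. *)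

(* Defs.v *)
From HB Require Import structures.
From mathcomp Require Import all_boot all_order all_algebra.
From mathcomp Require Import all_classical all_reals all_analysis.
Set Implicit Arguments.
Unset Strict Implicit.
Unset Printing Implicit Defensive.
Import Order.TTheory GRing.Theory Num.Theory.
Import numFieldNormedType.Exports.

Local Open Scope ring_scope.

(* A loop is an edge whose set of ends is a singleton; parallel edges are
   distinct elements of [edge G] with the same set of ends. *)
Record multigraph := Multigraph {
  vertex : finType;
  edge : finType;
  ends : edge -> {set vertex};
  card_ends : forall e, (1 <= #|ends e| <= 2)%N }.

Definition mg_adj (G : multigraph) : rel (vertex G) :=
  fun u v => [exists e : edge G, ends e == [set u; v]].

Definition induced_adj (G : multigraph) (S : {set vertex G}) : rel (vertex G) :=
  fun u v => [&& u \in S, v \in S & mg_adj u v].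

Definition induced_cluster (G : multigraph) (S : {set vertex G})
    (u : vertex G) : {set vertex G} :=
  [set v | connect (induced_adj S) u v].

Definition percolation_set (G : multigraph) (tau : nat) (S : {set vertex G}) :
    bool :=
  [forall u in S, (#|induced_cluster S u| <= tau)%N].

(* The default value 0 of the maximum is harmless: the ratios are nonnegative
   and the empty set is always a percolation set. *)
Definition alpha (R : realType) (tau : nat) (G : multigraph) : R :=
  \big[Num.max/0]_(S : {set vertex G} | percolation_set tau S)
    (#|S|%:R / #|vertex G|%:R).

Section Pairing.
Variable H : finType.

Definition is_pairing (M : {set {set H}}) : bool :=
  finset.partition M [set: H]%SET && [forall e in M, #|e| == 2%N].

Record pairing := Pairing { pairs : {set {set H}}; _ : is_pairing pairs }.

HB.instance Definition _ := [isSub for pairs].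
HB.instance Definition _ := [Finite of pairing by <:].

End Pairing.

(* The half-edge (v, i) is the i-th one emitted by the vertex v. *)
Definition half_edge (n d : nat) : finType := ('I_n * 'I_d)%type.

Section ConfigurationModel.
Variables (n d : nat) (M : pairing (half_edge n d)).

Definition config_edge : finType :=
  {e : {set half_edge n d} | e \in pairs M}.

Definition config_ends (e : config_edge) : {set 'I_n} :=
  [set h.1 | h in val e]%SET.

Lemma card_config_ends (e : config_edge) : (1 <= #|config_ends e| <= 2)%N.
Proof.
have /eqP e2 : #|val e| == 2%N.
  by have /andP[_ /forall_inP] := valP M; apply; exact: valP e.
apply/andP; split; last by rewrite -e2 leq_imset_card.
have /card_gt0P[h he] : (0 < #|val e|)%N by rewrite e2.
by apply/card_gt0P; exists h.1; apply: imset_f.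
Qed.

Definition config_multigraph : multigraph := Multigraph card_config_ends.

End ConfigurationModel.

(* Probability of the event [A] for the random multigraph G_(n,d), under the
   uniform law on pairings. It is only meaningful for n * d even: otherwise
   there is no pairing and the value is 0 / 0 = 0. *)
Definition prob_config (R : realType) (n d : nat) (A : pred multigraph) : R :=
  #|[set M : pairing (half_edge n d) | A (config_multigraph M)]%SET|%:R
    / #|{: pairing (half_edge n d)}|%:R.

(* Main.v *)
Require Import Defs.
From HB Require Import structures.
From mathcomp Require Import all_boot all_order all_algebra.
From mathcomp Require Import all_classical all_reals all_analysis.
From mathcomp Require Import ring lra zify.
Set Implicit Arguments.
Unset Strict Implicit.
Unset Printing Implicit Defensive.
Import Order.TTheory GRing.Theory Num.Theory.
Import numFieldNormedType.Exports.

Local Open Scope ring_scope.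

(** The proof is a first-moment computation, arranged so that a single
    generating function carries all of the probability.

    Deterministic part.  Let S be a percolation set with clusters of size at
    most tau.  Every pair of half-edges inside S stays inside one cluster, so
    if no set U of at most tau vertices spans more than #|U| edges, then S
    spans at most #|S| edges ([inner_percolation]).  It therefore suffices that
    with probability tending to 1
    - no set of at most tau vertices spans more edges than it has vertices
      ([card_dense_small]), and
    - no set of exactly s vertices, s being the least integer above
      (2 + eps) (log d / d) n, spans at most s edges ([card_sparse_large]);
      here a large percolation set is first shrunk to size s.

    Probabilistic part.  For a set A of half-edges let e(A) be the number of
    pairs of a uniform pairing that lie inside A.  Exposing the partner of one
    half-edge at a time gives a recursion for the sum of x ^ e(A) over all
    pairings; its solution [weight] depends only on the numbers of half-edges,
    and both estimates follow from it by Markov's inequality.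
    - With x = n and A of bounded size the expectation of n ^ e(A) is bounded
      ([weight_le_expr]).  So a set U of bounded size spans more than #|U|
      edges with probability O(n ^ -(#|U| + 1)), and the union bound costs
      O(1 / n).
    - With x < 1 the recursion gives
      E [x ^ e(A)] <= exp (- c #|A| (#|A| - 1) / (2 n d)) as soon as
      2 x <= 1 - c and A is not too large ([weight_le_expR]).  For s = b n this
      bounds the expected number of s-sets spanning at most s edges by the s-th
      power of a constant times (e / b) x^-1 exp (- c b d / 2).  For
      b = (2 + eps) log d / d the factor 1 / b is at most d, while
      exp (- c b d / 2) is d ^ - (c (1 + eps / 2)); taking
      c (1 + eps / 2) = 1 + eps / 4 leaves
      O (d ^ - (eps / 4)), which is at most 1 / 2 once d is large in terms of
      eps alone ([first_moment_base]).  Neither c nor x involves tau, which is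
      why d0 does not. *)

(** * Pairings of a finite set *)

Section Pairings.
Variable H : finType.
Implicit Types (D A : {set H}) (P : {set {set H}}).

(** Pairings of a subset [D], rather than of the whole type, so that removing a
    matched pair stays within the same notion. *)
Definition pairings D : {set {set {set H}}} :=
  [set P | finset.partition P D && [forall e in P, #|e| == 2%N]]%SET.

Definition inner P A : nat := #|[set e in P | e \subset A]%SET|.

Lemma pairingsP D P :
  reflect (finset.partition P D /\ forall e, e \in P -> #|e| = 2%N)
          (P \in pairings D).
Proof.
rewrite inE; apply: (iffP andP) => -[-> Pc]; split=> //.
  by move=> e eP; apply/eqP; move/forall_inP: Pc; apply.
by apply/forall_inP => e eP; rewrite Pc.
Qed.

(** What lets [sum_pairings] split a sum over pairings according to the partner
    of a chosen point. *)
Lemma card_mate D P h : P \in pairings D -> h \in D ->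
  #|[set h' in D :\ h | [set h; h'] \in P]%SET| = 1%N.
Proof.
move=> /pairingsP[Ppart P2] hD.
have trP := finset.partition_trivIset Ppart.
have hcov : h \in finset.cover P by rewrite (finset.cover_partition Ppart).
have hB : h \in finset.pblock P h by rewrite finset.mem_pblock.
have BP : finset.pblock P h \in P by rewrite finset.pblock_mem.
have /cards2P[x [y [xy Bxy]]] : #|finset.pblock P h| == 2%N by rewrite P2.
have [h' h'h Bh'] : exists2 h', h' != h & finset.pblock P h = [set h; h']%SET.
  move: hB; rewrite Bxy !inE => /orP[]/eqP->; first by exists y; rewrite // eq_sym.
  by exists x => //; rewrite finset.setUC.
suff -> : [set h' in D :\ h | [set h; h'] \in P]%SET = [set h']%SET by rewrite cards1.
apply/setP => z; rewrite !inE; apply/idP/eqP => [/andP[/andP[zh zD] hzP]|->].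
  have : [set h; z]%SET = [set h; h']%SET.
    by rewrite -Bh' (finset.def_pblock trP hzP) // !inE eqxx.
  by move/setP/(_ z); rewrite !inE eqxx orbT (negPf zh) /= => /esym/eqP.
rewrite h'h -Bh' BP andbT /= -(finset.cover_partition Ppart).
by apply/bigcupP; exists (finset.pblock P h); rewrite // Bh' !inE eqxx orbT.
Qed.

Lemma pairingsU1 D h h' P : h \in D -> h' \in D :\ h ->
  P \in pairings (D :\ h :\ h') -> ([set h; h'] |: P)%SET \in pairings D.
Proof.
move=> hD /setD1P[h'h h'D] /pairingsP[Ppart P2].
apply/pairingsP; split; last first.
  move=> e; rewrite !inE => /orP[/eqP->|/P2//].
  by rewrite cards2 eq_sym h'h.
have -> : D = [set h; h']%SET :|: (D :\ h :\ h')%SET.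
  apply/setP => z; rewrite !inE.
  have [->|_] := eqVneq z h; first by rewrite hD.
  by have [->|_] := eqVneq z h'; rewrite ?h'D.
apply: partitionU1 => //.
  by apply/set0Pn; exists h; rewrite !inE eqxx.
rewrite finset.disjoints_subset; apply/fintype.subsetP => z; rewrite !inE => /orP[]/eqP->; rewrite eqxx //.
by rewrite /= andbF.
Qed.

Lemma pairingsD1 D h h' P : h' != h ->
  P \in pairings D -> [set h; h']%SET \in P ->
  (P :\ [set h; h'])%SET \in pairings (D :\ h :\ h').
Proof.
move=> h'h /pairingsP[Ppart P2] eP.
apply/pairingsP; split; last by move=> e /setD1P[_ /P2].
have -> : (D :\ h :\ h')%SET = (D :\: [set h; h'])%SET.
  by apply/setP => z; rewrite !inE; case: (z == h); case: (z == h').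
by apply: partitionD1.
Qed.

Lemma pair_notin D h h' P : P \in pairings (D :\ h :\ h') -> [set h; h']%SET \notin P.
Proof.
move=> /pairingsP[Ppart _]; apply/negP => eP.
have : h \in finset.cover P by apply/bigcupP; exists [set h; h']%SET; rewrite // !inE eqxx.
by rewrite (finset.cover_partition Ppart) !inE eqxx /= andbF.
Qed.

(** Exposing the partner [h'] of [h] leaves an arbitrary pairing of the rest. *)
Lemma sum_pairings (R : nmodType) D h (f : {set {set H}} -> R) : h \in D ->
  \sum_(P in pairings D) f P =
  \sum_(h' in D :\ h) \sum_(P in pairings (D :\ h :\ h')) f ([set h; h'] |: P)%SET.
Proof.
move=> hD.
(* [card_mate] inserts a sum with exactly one term. *)
transitivity (\sum_(P in pairings D)
    \sum_(h' in D :\ h | [set h; h']%SET \in P) f P).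
  apply: eq_bigr => P PD; rewrite -[LHS]mulr1n -(card_mate PD hD) -sumr_const.
  by apply: eq_bigl => h'; rewrite inE.
rewrite (exchange_big_dep (fun h' => h' \in D :\ h)) /=; last by move=> ? ? _ /andP[].
apply: eq_bigr => h' h'D; have h'h : h' != h by move: h'D; rewrite !inE => /andP[].
rewrite (reindex_onto (fun P => [set h; h'] |: P)%SET (fun P => P :\ [set h; h']%SET)) /=; last first.
  by move=> P /and3P[PD _ eP]; rewrite finset.setD1K.
apply: eq_bigl => P; apply/idP/idP => [/andP[/andP[PD _] /eqP eqP]|PD].
  by rewrite -{}eqP; apply: pairingsD1 => //; rewrite !inE eqxx.
rewrite (pairingsU1 hD h'D PD) h'D !inE eqxx /=; apply/eqP.
by rewrite setU1K // (pair_notin PD).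
Qed.

Lemma inner_pairU1 D h h' P A : P \in pairings (D :\ h :\ h') ->
  inner ([set h; h'] |: P)%SET A = ((h \in A) && (h' \in A) + inner P A)%N.
Proof.
move=> /pair_notin eP; rewrite /inner.
have sE : ([set h; h']%SET \subset A) = (h \in A) && (h' \in A).
  by rewrite finset.subUset !finset.sub1set.
case: (boolP (_ && _)) => hA.
  rewrite (_ : [set e in _ | _]%SET = [set h; h']%SET |: [set e in P | e \subset A]%SET) ?cardsU1.
    by rewrite inE negb_and eP.
  apply/setP => e; rewrite !inE andb_orl; case: eqVneq => //= ->.
  by rewrite sE hA.
congr #|pred_of_set _|; apply/setP => e; rewrite !inE andb_orl; case: eqVneq => //= ->.
by rewrite sE (negPf hA) (negPf eP).
Qed.

End Pairings.

(** The generating function of the number of inner pairs of [m] marked points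
    over all pairings of 2k points.  A marked point is exposed as long as there
    is one: with 2k + 2 points of which m + 1 are marked, its partner is one of
    m marked points, which gains a factor x, or of 2k + 1 - m unmarked ones. *)
Fixpoint weight (R : pzRingType) (x : R) (k m : nat) : R :=
  if k is k'.+1 then
    if m is m'.+1 then
      m'%:R * (x * weight x k' m'.-1) + (k'.*2.+1 - m')%:R * weight x k' m'
    else k'.*2.+1%:R * weight x k' 0
  else 1.

Section PairingsWeight.
Variables (R : comPzRingType) (H : finType).
Implicit Types (D A : {set H}).

(** The sum depends on [D] and [A] only through two cardinals because the
    recursion of [sum_pairings] does. *)
Lemma sum_pairings_weight (x : R) (k : nat) D A : #|D| = k.*2 ->
  \sum_(P in pairings D) x ^+ inner P A = weight x k #|A :&: D|.
Proof.
elim: k D => [|k IHk] D Dk.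
  have -> : D = finset.set0 by apply/eqP; rewrite -cards_eq0 Dk.
  rewrite (big_pred1 finset.set0) => [|P]; last first.
    rewrite inE finset.partition_set0 /=; case: eqVneq => //= ->.
    by apply/forall_inP => e; rewrite inE.
  suff -> : inner finset.set0 A = 0%N by [].
  by apply/eqP; rewrite cards_eq0; apply/eqP/setP => e; rewrite !inE.
have cardD2 h h' : h \in D -> h' \in D :\ h -> #|D :\ h :\ h'| = k.*2.
  move=> hD h'D; have := cardsD1 h D; rewrite hD Dk (cardsD1 h') h'D => /eqP.
  by rewrite doubleS !eqSS => /eqP.
have step h : h \in D -> \sum_(P in pairings D) x ^+ inner P A =
    \sum_(h' in D :\ h) x ^+ ((h \in A) && (h' \in A)) * weight x k #|A :&: (D :\ h :\ h')|.
  move=> hD; rewrite (sum_pairings _ hD); apply: eq_bigr => h' h'D.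
  rewrite -(IHk _ (cardD2 _ _ hD h'D)) mulr_sumr; apply: eq_bigr => P PD.
  by rewrite (inner_pairU1 _ PD) exprD.
case: (finset.set_0Vmem (A :&: D)) => [AD0|[h]].
  have /card_gt0P[h hD] : (0 < #|D|)%N by rewrite Dk.
  have hA : h \notin A.
    apply/negP => hA; have : h \in A :&: D by rewrite inE hA.
    by rewrite AD0 inE.
  rewrite (step h hD) AD0 cards0 /=.
  rewrite (eq_bigr (fun=> weight x k 0)) => [|h' h'D].
    rewrite sumr_const -[LHS]mulr_natl; congr (_%:R * _).
    by have := cardsD1 h D; rewrite hD Dk => /eqP; rewrite doubleS eqSS => /eqP.
  rewrite (negPf hA) mul1r; congr weight; apply/eqP; rewrite cards_eq0 -finset.subset0 -AD0.
  by apply: finset.setIS; rewrite (fintype.subset_trans (subD1set _ _)) ?subD1set.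
rewrite inE => /andP[hA hD]; rewrite (step h hD) hA /=.
have [m Em] : exists m, #|A :&: D| = m.+1.
  by exists #|A :&: D|.-1; rewrite prednK //; apply/card_gt0P; exists h; rewrite inE hA.
have Em' : #|A :&: (D :\ h)| = m.
  apply/eqP; rewrite -eqSS -Em (cardsD1 h (A :&: D)) inE hA hD add1n.
  by rewrite -finset.setIDA finset.setIDA.
rewrite Em /= (bigID (mem A)) /=; congr (_ + _).
  rewrite (eq_bigr (fun=> x * weight x k m.-1)) => [|h' /andP[h'D h'A]].
    rewrite (eq_bigl (mem (A :&: (D :\ h))%SET)) => [|h']; last by rewrite !inE andbC.
    by rewrite sumr_const -[LHS]mulr_natl Em'.
  rewrite h'A expr1; congr (_ * weight _ _ _); rewrite -Em' (cardsD1 h' (A :&: (D :\ h))).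
  by rewrite inE h'A h'D /= finset.setIDA.
rewrite (eq_bigr (fun=> weight x k m)) => [|h' /andP[h'D h'A]].
  rewrite (eq_bigl (mem ((D :\ h) :\: A)%SET)) => [|h']; last by rewrite !inE andbC.
  rewrite sumr_const -[LHS]mulr_natl cardsD finset.setIC Em'; congr ((_ - _)%:R * _).
  by have := cardsD1 h D; rewrite hD Dk => /eqP; rewrite doubleS eqSS => /eqP.
rewrite (negPf h'A) mul1r; congr weight; rewrite -Em' finset.setIDA; congr #|pred_of_set _|.
apply/setP => z; rewrite !inE; case: eqVneq => // ->.
by rewrite (negPf h'A).
Qed.

End PairingsWeight.

(** * Bounds on the generating function *)

Section WeightBounds.
Variable R : realType.
Implicit Types (x c t : R).

Lemma weight_ge0 x k m : 0 <= x -> 0 <= weight x k m.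
Proof.
move=> x0; elim: k m => [|k IHk] [|m] //=; first by rewrite mulr_ge0.
by rewrite addr_ge0 ?mulr_ge0.
Qed.

Lemma weight0_gt0 x k : 0 < weight x k 0.
Proof. by elim: k => [|k IHk] //=; rewrite mulr_gt0. Qed.

(** Comparison principle: as the recursion has nonnegative coefficients, a
    function [g] that satisfies it with an inequality bounds the expectation.
    The factor [weight x k 0] is the number of pairings, and [inv] restricts the
    region of (k, m) that the recursion visits. *)
Lemma weight_le (inv : nat -> nat -> Prop) (g : nat -> R) x :
  0 <= x -> g 0%N = 1 ->
  (forall k m, inv k.+1 m.+1 -> inv k m /\ inv k m.-1) ->
  (forall k m, inv k.+1 m.+1 -> (m <= k.*2.+1)%N ->
     m%:R * (x * g m.-1) + (k.*2.+1 - m)%:R * g m <= k.*2.+1%:R * g m.+1) ->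
  forall k m, (m <= k.*2)%N -> inv k m -> weight x k m <= weight x k 0 * g m.
Proof.
move=> x0 g0 inv_step g_step; elim=> [|k IHk] [|m] // mk invkm; rewrite ?g0 ?mulr1 //.
have {}mk : (m <= k.*2.+1)%N by move: mk; rewrite doubleS ltnS.
have [invm invm1] := inv_step _ _ invkm.
have Dk0 : 0 <= weight x k 0 by apply: weight_ge0.
have w1 : weight x k m.-1 <= weight x k 0 * g m.-1.
  by apply: IHk => //; case: (m) mk.
(* When all points are marked, [m] exceeds the range of the induction
   hypothesis, but then there is no unmarked partner. *)
have w0 : (k.*2.+1 - m)%:R * weight x k m <= (k.*2.+1 - m)%:R * (weight x k 0 * g m).
  have [->|mk'] := eqVneq m k.*2.+1; first by rewrite subnn !mul0r.
  by apply: ler_wpM2l => //; apply: IHk => //; rewrite -ltnS ltn_neqAle mk'.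
have w2 : m%:R * (x * weight x k m.-1) <= m%:R * (x * (weight x k 0 * g m.-1)).
  by do 2!apply: ler_wpM2l => //.
rewrite /=; apply: le_trans (lerD w2 w0) _.
have := ler_wpM2l Dk0 (g_step k m invkm mk).
by rewrite mulrDr; congr (_ + _ <= _); ring.
Qed.

(** The expected number of inner pairs is mu, about m^2 / (4 k0), and the bound
    is essentially exp (- c mu), as compared with exp (- (1 - x) mu) for a
    Poisson variable of mean mu.  The step of the recursion
    reads, to first order in a = c / (2 k0), as x e^(a m) <= 1 - (2k + 1) a, and
    (2k + 1) a <= c; the assumption e^(a m) <= 2 turns this into
    2 x <= 1 - c. *)
Lemma weight_le_expR x c k0 m : 0 <= x -> 0 <= c -> x * 2 <= 1 - c ->
  (0 < k0)%N -> expR (c * m%:R / k0.*2%:R) <= 2 -> (m <= k0.*2)%N ->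
  weight x k0 m <= weight x k0 0 * expR (- (c / k0.*2%:R * 'C(m, 2)%:R)).
Proof.
move=> x0 c0 xc k0gt0 ec mk.
have N0 : 0 < k0.*2%:R :> R by rewrite ltr0n double_gt0.
set a := c / k0.*2%:R; have a0 : 0 <= a by rewrite divr_ge0 // ltW.
pose g j : R := expR (- (a * 'C(j, 2)%:R)).
have gS j : g j = g j.+1 * expR (a * j%:R).
  by rewrite /g -expRD binS bin1 natrD; congr expR; ring.
apply: (@weight_le (fun k j => (k <= k0)%N /\ (j <= m)%N) g) => //.
- by rewrite /g mulr0 oppr0 expR0.
- by move=> k j; lia.
move=> k j [kk0 jm] jk.
rewrite natrB // [g j]gS.
have [->|j0] := posnP j; first by rewrite mul0r add0r !mulr0 expR0 subr0 mulr1.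
have -> : g j.-1 = g j * expR (a * j.-1%:R) by rewrite gS prednK.
rewrite [g j]gS.
set y := expR (a * j%:R); set z := expR (a * j.-1%:R).
have G0 : 0 <= g j.+1 by apply: expR_ge0.
have y0 : 0 <= y by apply: expR_ge0.
have z2 : x * z <= 1 - c.
  apply: le_trans xc; apply: ler_wpM2l => //; apply: le_trans ec.
  rewrite ler_expR /a mulrAC ler_wpM2r ?invr_ge0 ?(ltW N0) // ler_wpM2l // ler_nat.
  by lia.
have ka : k.*2.+1%:R * a <= c.
  rewrite /a mulrCA ler_piMr // ler_pdivrMr // mul1r ler_nat; lia.
have yV : y * (1 - a * j%:R) <= 1.
  have := expR_ge1Dx (- (a * j%:R)); rewrite -/y expRN -/y => h.
  by apply: le_trans (ler_wpM2l y0 h) _; rewrite mulfV // lt0r_neq0 ?expR_gt0.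
(* The step of the recursion, divided by [g j], with [1 - a * j] in place of the
   larger [expR (- (a * j))]. *)
have key : j%:R * (x * z) + (k.*2.+1%:R - j%:R) <= k.*2.+1%:R * (1 - a * j%:R).
  have h1 : j%:R * (x * z) <= j%:R * (1 - k.*2.+1%:R * a).
    by apply: ler_wpM2l => //; apply: le_trans z2 _; rewrite lerD2l lerN2.
  by apply: le_trans (lerD h1 (lexx _)) _; rewrite le_eqVlt; apply/orP; left; apply/eqP; ring.
have := ler_wpM2l y0 key.
have := ler_wpM2l (ler0n _ k.*2.+1) yV.
move=> h1 h2.
have h3 : y * (j%:R * (x * z) + (k.*2.+1%:R - j%:R)) <= k.*2.+1%:R.
  by apply: le_trans h2 _; rewrite mulrCA; apply: le_trans h1 _; rewrite mulr1.
have := ler_wpM2l G0 h3; congr (_ <= _); ring.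
Qed.

(** Each exposure multiplies the expectation by at most 1 + t when
    x m <= t (2k + 1).  The invariant j + L <= k keeps at least 2 L points
    available throughout, since an exposure removes two points and at least one
    of them is marked. *)
Lemma weight_le_expr x t L k0 m : 0 <= x -> 0 <= t -> (m + L <= k0)%N ->
  x * m%:R <= t * L.*2%:R ->
  weight x k0 m <= weight x k0 0 * (1 + t) ^+ m.
Proof.
move=> x0 t0 mL xt.
apply: (@weight_le (fun k j => (j + L <= k)%N /\ (j <= m)%N) (fun j => (1 + t) ^+ j)) => //.
- by move=> k j; lia.
- move=> k j [jk jm] jk2; rewrite natrB //.
  have [->|j0] := posnP j.
    by rewrite mul0r add0r subr0 expr0 ler_wpM2l // expr1 lerDl.
  rewrite -(prednK j0) /= !exprS; set G := (1 + t) ^+ j.-1.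
  have G0 : 0 <= G by rewrite exprn_ge0 // addr_ge0.
  rewrite (prednK j0).
  have h : j%:R * x <= k.*2.+1%:R * t.
    rewrite mulrC (le_trans (y := x * m%:R)) //.
      by apply: ler_wpM2l => //; rewrite ler_nat; lia.
    by apply: (le_trans xt); rewrite mulrC ler_wpM2r // ler_nat; lia.
  have j0' : 0 <= j%:R :> R by [].
  have k0' : 0 <= k.*2.+1%:R :> R by [].
  have : j%:R * x + (k.*2.+1%:R - j%:R) * (1 + t) <= k.*2.+1%:R * (1 + t) * (1 + t) by nra.
  by move/(ler_wpM2l G0); congr (_ <= _); ring.
- by lia.
Qed.

End WeightBounds.

(** * Markov's inequality and union bounds *)

Section Counting.
Variables (R : realType) (H : finType) (k : nat).
Hypothesis card_H : #|H| = k.*2.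
Implicit Types (A : {set H}) (x : R).

Lemma sum_pairing_weight x A :
  \sum_(M : pairing H) x ^+ inner (pairs M) A = weight x k #|A|.
Proof.
rewrite -[in RHS](finset.setIT A) -sum_pairings_weight ?cardsT //.
rewrite (reindex_omap (@pairs H) insub) => [|P PH]; last first.
  by move: PH; rewrite inE => PH; rewrite insubT.
apply: eq_bigl => M; rewrite valK eqxx andbT inE; apply/esym.
exact: (valP M).
Qed.

Lemma card_pairing x : #|{: pairing H}|%:R = weight x k 0.
Proof.
rewrite -(cards0 H) -sum_pairing_weight -sum1_card natr_sum; apply: eq_bigr => M _.
suff -> : inner (pairs M) finset.set0 = 0%N by [].
apply/eqP; rewrite cards_eq0; apply/eqP/setP => e; rewrite !inE finset.subset0.
apply/negP => /andP[eM /eqP e0]; have /andP[_ /forall_inP/(_ e eM)] := valP M.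
by rewrite e0 cards0.
Qed.

Lemma card_inner_le x A s : 0 < x <= 1 ->
  #|[set M : pairing H | (inner (pairs M) A <= s)%N]%SET|%:R <= x ^- s * weight x k #|A|.
Proof.
move=> /andP[x0 x1]; rewrite -ler_pdivrMl ?invr_gt0 ?exprn_gt0 // invrK.
rewrite -sum_pairing_weight -sum1_card natr_sum mulr_sumr big_mkcond /=.
apply: ler_sum => M _; rewrite inE; case: ifP => Ms; last by rewrite exprn_ge0 // ltW.
by rewrite mulr1 ler_wiXn2l // ltW.
Qed.

Lemma card_inner_ge x A j : 1 <= x ->
  #|[set M : pairing H | (j <= inner (pairs M) A)%N]%SET|%:R <= x ^- j * weight x k #|A|.
Proof.
move=> x1; have x0 : 0 < x by apply: lt_le_trans x1.
rewrite -ler_pdivrMl ?invr_gt0 ?exprn_gt0 // invrK.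
rewrite -sum_pairing_weight -sum1_card natr_sum mulr_sumr big_mkcond /=.
apply: ler_sum => M _; rewrite inE; case: ifP => Ms; last by rewrite exprn_ge0 // ltW.
by rewrite mulr1 ler_weXn2l.
Qed.

End Counting.

Section SetSums.
Variable R : realType.

(** Used both for the sum of n ^ -#|U| over all U, which is at most e, and for
    the bound y ^ s C(n, s) <= (1 + y) ^ n. *)
Lemma sum_set_expr (T : finType) (y : R) :
  \sum_(U : {set T}) y ^+ #|U| = (1 + y) ^+ #|T|.
Proof.
rewrite -prodr_const addrC finset.bigA_distr; apply: eq_bigr => U _.
by rewrite -big_mkcond /= prodr_const.
Qed.

Lemma card_exists_le (I J : finType) (D : {pred J}) (Q : J -> {pred I}) :
  #|[set i | [exists j in D, Q j i]]%SET|%:R <= \sum_(j in D) #|[set i | Q j i]%SET|%:R :> R.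
Proof.
rewrite -sum1_card natr_sum big_mkcond /=.
under [leRHS]eq_bigr => j _ do rewrite -sum1_card natr_sum big_mkcond /=.
rewrite exchange_big /=; apply: ler_sum => i _; rewrite inE.
case: ifP => [/exists_inP[j jD Qji]|_]; last by apply: sumr_ge0 => j _; case: ifP.
by rewrite (bigD1 j) //= inE Qji lerDl; apply: sumr_ge0 => j' _; case: ifP.
Qed.

End SetSums.

(** * Clusters of a percolation set *)

Section Clusters.
Variables (n d : nat) (M : pairing (half_edge n d)).
Implicit Types (U S : {set 'I_n}).

Definition emitted U : {set half_edge n d} := finset.setX U [set: 'I_d]%SET.

Lemma card_emitted U : #|emitted U| = (#|U| * d)%N.
Proof. by rewrite cardsX cardsT card_ord. Qed.

Lemma emitted_sub (e : {set half_edge n d}) U : (e \subset emitted U) = ([set h.1 | h in e]%SET \subset U).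
Proof.
apply/fintype.subsetP/fintype.subsetP => [eU _ /imsetP[h he ->]|eU h he].
  by have := eU h he; rewrite inE => /andP[].
by rewrite inE inE andbT; apply: eU; apply: imset_f.
Qed.

(** The clusters partition [S], and the two ends of an edge inside [S] lie in
    the same cluster, so the bounds for the clusters add up. *)
Lemma inner_percolation tau S :
  (forall U, (#|U| <= tau)%N -> (inner (pairs M) (emitted U) <= #|U|)%N) ->
  percolation_set (G := config_multigraph M) tau S ->
  (inner (pairs M) (emitted S) <= #|S|)%N.
Proof.
move=> small percS.
pose adj : rel 'I_n := @induced_adj (config_multigraph M) S.
have adjC : connect_sym adj.
  apply: sym_connect_sym => u v; rewrite /adj /induced_adj andbCA; congr [&& _, _ & _].
  by apply: eq_existsb => e; rewrite finset.setUC.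
(* A canonical vertex of each cluster, so that clusters are indexed by vertices;
   [cl w] is empty when [w] represents no cluster. *)
pose r := fingraph.root adj.
have adjr u v : adj u v -> r u = r v by move=> uv; apply/eqP; rewrite root_connect // connect1.
pose cl w := [set u in S | r u == w]%SET.
have cl_small w : (inner (pairs M) (emitted (cl w)) <= #|cl w|)%N.
  apply: small; case: (finset.set_0Vmem (cl w)) => [->|[u]]; first by rewrite cards0.
  rewrite inE => /andP[uS /eqP ruw]; move/forall_inP: percS => /(_ u uS).
  apply: leq_trans; apply: subset_leq_card; apply/fintype.subsetP => v.
  by rewrite !inE -ruw eq_sym /r root_connect // => /andP[].
have -> : #|S| = (\sum_(w : 'I_n) #|cl w|)%N.
  rewrite -sum1_card (partition_big r xpredT) //=; apply: eq_bigr => w _.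
  by rewrite -sum1_card; apply: eq_bigl => u; rewrite inE.
apply: (@leq_trans (\sum_(w : 'I_n) inner (pairs M) (emitted (cl w)))%N); last exact: leq_sum.
rewrite /inner -sum1_card.
under [leqRHS]eq_bigr => w _ do rewrite -sum1_card big_mkcond.
rewrite exchange_big /= big_mkcond; apply: leq_sum => e _.
rewrite inE; case: ifP => // /andP[eM eS].
have [h he] : exists h, h \in e.
  apply/card_gt0P; have /andP[_ /forall_inP/(_ e eM)/eqP->] := valP M.
  by [].
rewrite (bigD1 (r h.1)) //= inE eM emitted_sub /=.
suff -> : [set h.1 | h in e]%SET \subset cl (r h.1) by [].
move: eS; rewrite emitted_sub => eS.
apply/fintype.subsetP => _ /imsetP[h' h'e ->]; rewrite inE.
have S1 g : g \in e -> g.1 \in S by move=> ge; apply: (fintype.subsetP eS); apply: imset_f.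
rewrite S1 //=; apply/eqP; have [->//|h'h] := eqVneq h' h.
apply: adjr; rewrite /adj /induced_adj !S1 //=; apply/existsP.
exists (exist _ e eM); apply/eqP; rewrite /= /config_ends /=.
have -> : e = [set h'; h]%SET.
  apply/esym/eqP; rewrite eqEcard cards2 h'h /=.
  have /andP[_ /forall_inP/(_ e eM)/eqP->] := valP M; rewrite andbT.
  by apply/fintype.subsetP => g; rewrite !inE => /orP[]/eqP->.
by rewrite finset.imsetU1 imset_set1.
Qed.

End Clusters.

Lemma percolation_sub (G : multigraph) tau (S S' : {set vertex G}) :
  S' \subset S -> percolation_set tau S -> percolation_set tau S'.
Proof.
move=> S'S /forall_inP percS; apply/forall_inP => u uS'.
apply: leq_trans (percS u (fintype.subsetP S'S u uS')).
apply: subset_leq_card; apply/fintype.subsetP => v; rewrite !inE.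
apply: connect_sub => a b /and3P[aS' bS' ab]; apply: connect1.
by rewrite /induced_adj !(fintype.subsetP S'S).
Qed.

Lemma subset_of_card (T : finType) (S : {set T}) s : (s <= #|S|)%N ->
  exists2 S' : {set T}, S' \subset S & #|S'| = s.
Proof.
move=> sS; exists [set x in take s (enum S)]%SET.
  by apply/fintype.subsetP => x; rewrite inE => /mem_take; rewrite mem_enum.
rewrite cardsE (card_uniqP _) ?take_uniq ?enum_uniq // size_takel //.
by rewrite -cardE.
Qed.

(** * The two first-moment bounds *)

Section FirstMoment.
Variables (R : realType) (n d k : nat).
Hypotheses (n_gt0 : (0 < n)%N) (d_gt0 : (0 < d)%N) (Ek : (n * d)%N = k.*2).

Let card_H : #|half_edge n d| = k.*2.
Proof. by rewrite card_prod !card_ord. Qed.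

Let T : R := #|{: pairing (half_edge n d)}|%:R.

Let n0 : 0 < n%:R :> R. Proof. by rewrite ltr0n. Qed.

Lemma card_pairing_gt0 : 0 < T.
Proof. by rewrite /T (card_pairing card_H 1) weight0_gt0. Qed.

(** Markov's inequality for n ^ e(U).  The bound n ^ -(#|U| + 1) beats the number
    of sets [U] of each size by a factor n. *)
Lemma card_dense_small tau : (4 * tau <= n)%N ->
  #|[set M : pairing (half_edge n d) |
     [exists U in [pred U : {set 'I_n} | (#|U| <= tau)%N],
       (#|U| < inner (pairs M) (emitted d U))%N]]%SET|%:R
    <= T * (expR 1 * (1 + 2 * tau%:R) ^+ (tau * d) / n%:R).
Proof.
move=> taun; apply: le_trans (card_exists_le _ _ _) _.
set C := _ ^+ (tau * d).
have C0 : 0 <= C by rewrite exprn_ge0 // addr_ge0 // mulr_ge0.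
have T0 := ltW card_pairing_gt0.
(* Dropping the restriction on #|U| makes the sum a power. *)
apply: (@le_trans _ _ (\sum_(U : {set 'I_n}) n%:R^-1 ^+ #|U| * (T * C / n%:R))).
  rewrite [leRHS](bigID [pred U : {set 'I_n} | (#|U| <= tau)%N]) /=.
  rewrite -[leLHS]addr0; apply: lerD; last first.
    by apply: sumr_ge0 => U _; rewrite !mulr_ge0 ?exprn_ge0 ?invr_ge0.
  apply: ler_sum => U Utau; apply: le_trans (card_inner_ge card_H (x := n%:R) _ _ _) _.
    by rewrite ler1n.
  rewrite exprS invfM -exprVn card_emitted [n%:R^-1 * _]mulrC -[leLHS]mulrA.
  apply: ler_wpM2l; first by rewrite exprn_ge0 // invr_ge0.
  rewrite mulrC; apply: ler_wpM2r; first by rewrite invr_ge0.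
  (* [t = 2 tau] and [L = k - #|U| d]: at least half of the n d half-edges remain,
     as 4 tau <= n. *)
  have Utau' : (#|U| <= tau)%N by [].
  have Ud : (4 * (#|U| * d) <= k.*2)%N.
    by rewrite -Ek mulnA leq_mul2r (leq_trans _ taun) ?orbT // leq_mul2l.
  apply: le_trans (@weight_le_expr _ _ (2 * tau%:R) (k - #|U| * d) _ _ _ _ _ _) _ => //.
  - by lia.
  - rewrite -!natrM ler_nat mulnCA [(2 * tau)%N]mulnC -mulnA leq_mul //.
    by rewrite Ek; lia.
  rewrite -(card_pairing card_H); apply: ler_wpM2l => //.
  by rewrite ler_weXn2l ?lerDl ?mulr_ge0 // leq_mul2r Utau' orbT.
rewrite -mulr_suml sum_set_expr card_ord.
rewrite [leRHS](_ : _ = expR 1 * (T * C / n%:R)); last by ring.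
rewrite ler_wpM2r ?divr_ge0 ?mulr_ge0 //.
apply: (@le_trans _ _ (expR n%:R^-1 ^+ n)).
  by rewrite lerXn2r ?nnegrE ?expR_ge0 ?addr_ge0 ?invr_ge0 ?expR_ge1Dx.
by rewrite -expRM_natl mulfV // lt0r_neq0.
Qed.

(** The factor n e / s is the s-th root of the usual bound on C(n, s), 1 / x comes
    from Markov's inequality for x ^ e(S) at the threshold s, and the
    exponential is [weight_le_expR] for the s d half-edges of [S]. *)
Lemma card_sparse_large (x c : R) s : 0 < x -> 0 <= c -> x * 2 <= 1 - c ->
  (0 < s)%N -> (s.*2 <= n)%N ->
  #|[set M : pairing (half_edge n d) |
     [exists S in [pred S : {set 'I_n} | #|S| == s],
       (inner (pairs M) (emitted d S) <= s)%N]]%SET|%:R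
    <= T * (n%:R / s%:R * (expR 1 / x)
         * expR (- (c * ((s * d)%:R - 1) / n.*2%:R))) ^+ s.
Proof.
move=> x0 c0 xc s_gt0 sn; apply: le_trans (card_exists_le _ _ _) _.
have T0 := ltW card_pairing_gt0.
have s0 : 0 < s%:R :> R by rewrite ltr0n.
pose g := expR (- (c * ((s * d)%:R - 1) / n.*2%:R)).
have k0 : (0 < k)%N by lia.
(* The size condition of [weight_le_expR]: the exponent is c s / n <= 1 / 2. *)
have half_le : expR (c * (s * d)%:R / k.*2%:R) <= 2.
  have h2 : expR 2^-1 <= 2 :> R.
    have := @expR_ge1Dx R (- 2^-1); rewrite expRN => h.
    rewrite -[leLHS]invrK -[leRHS]invrK lef_pV2 ?posrE ?invr_gt0 ?expR_gt0 //.
    by apply: le_trans h; lra.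
  apply: le_trans h2; rewrite ler_expR ler_pdivrMr ?ltr0n ?double_gt0 //.
  have c1 : c <= 1 by lra.
  apply: (@le_trans _ _ (s * d)%:R); first by rewrite ler_piMl.
  by rewrite ler_pdivlMl // -natrM ler_nat; nia.
apply: (@le_trans _ _ (\sum_(S : {set 'I_n} | #|S| == s) (x ^- s * (T * g ^+ s)))).
  apply: ler_sum => S /eqP Ss; apply: le_trans (card_inner_le card_H (x := x) _ _ _) _.
    by rewrite x0 /=; lra.
  apply: ler_wpM2l; first by rewrite invr_ge0 exprn_ge0 // ltW.
  rewrite card_emitted Ss; apply: le_trans (@weight_le_expR _ x c _ _ _ _ _ _ _ _) _ => //.
  - exact: ltW.
  - by nia.
  rewrite -(card_pairing card_H) ler_wpM2l // /g -expRM_natl ler_expR.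
  rewrite -Ek mulrN lerN2.
  have -> : 'C(s * d, 2)%:R = (s * d)%:R * ((s * d)%:R - 1) / 2 :> R.
    have := mul_bin_diag (s * d) 1; rewrite bin1 => /(congr1 (fun m => m%:R : R)).
    by rewrite !natrM -subn1 natrB ?muln_gt0 ?s_gt0 // natrM => ->; rewrite mulrC mulKf.
  rewrite -mul2n !natrM le_eqVlt; apply/orP; left; apply/eqP.
  field; rewrite ?lt0r_neq0 // ltr0n //.
rewrite sumr_const; set N := #|_|.
(* Number of s-sets: the optimal y in y ^ s C(n, s) <= (1 + y) ^ n is about
   s / n. *)
pose y : R := s%:R / n%:R; have y0 : 0 < y by rewrite divr_gt0.
have hN : N%:R * y ^+ s <= expR 1 ^+ s.
  apply: (@le_trans _ _ ((1 + y) ^+ n)).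
    have -> : N%:R * y ^+ s = \sum_(S : {set 'I_n} | #|S| == s) y ^+ #|S|.
      rewrite (eq_bigr (fun=> y ^+ s)) => [|S /eqP->//].
      by rewrite sumr_const mulr_natl.
    rewrite -[X in (1 + y) ^+ X]card_ord -sum_set_expr big_mkcond /=.
    by apply: ler_sum => S _; case: ifP => // _; rewrite exprn_ge0 // ltW.
  apply: (@le_trans _ _ (expR y ^+ n)).
    by rewrite lerXn2r ?nnegrE ?expR_ge0 ?addr_ge0 ?(ltW y0) ?expR_ge1Dx.
  by rewrite -!expRM_natl mulr1 /y mulrCA mulfV ?lt0r_neq0 // mulr1.
have -> : n%:R / s%:R = y^-1 by rewrite invf_div.
rewrite -/g !exprMn -!exprVn.
have Y0 : 0 <= y^-1 ^+ s by rewrite exprn_ge0 // invr_ge0 ltW.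
have Z0 : 0 <= T * x^-1 ^+ s * g ^+ s.
  by rewrite !mulr_ge0 // exprn_ge0 ?invr_ge0 ?expR_ge0 // ltW.
have yy : y^-1 ^+ s * y ^+ s = 1 by rewrite -exprMn mulVf ?expr1n // lt0r_neq0.
have := ler_wpM2l (mulr_ge0 Y0 Z0) hN.
rewrite [leLHS](_ : _ = y^-1 ^+ s * y ^+ s * (T * x^-1 ^+ s * g ^+ s * N%:R)); last by ring.
rewrite yy mul1r => h.
rewrite [leLHS](_ : _ = T * x^-1 ^+ s * g ^+ s * N%:R); last by ring.
rewrite [leRHS](_ : _ = y^-1 ^+ s * (T * x^-1 ^+ s * g ^+ s) * expR 1 ^+ s) //; last by ring.
Qed.

End FirstMoment.

(** * Large degree and many vertices *)

Section Asymptotics.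
Variable R : realType.

(** With l = ln d, the three factors are at most e^l, e / x and
    e^(1 - (1 + eps / 4) l), because n / s <= d / ((2 + eps) l) <= d and
    s d / n >= (2 + eps) l. *)
Lemma first_moment_base (eps c x : R) (d n s : nat) :
  0 < eps -> 0 <= c <= 1 -> c * (1 + eps / 2) = 1 + eps / 4 -> 0 < x ->
  1 <= ln d%:R :> R -> 4 / eps * ln (2 * expR 2 / x) <= ln d%:R ->
  (0 < n)%N -> (2 + eps) * (ln d%:R / d%:R) * n%:R <= s%:R ->
  n%:R / s%:R * (expR 1 / x) * expR (- (c * ((s * d)%:R - 1) / n.*2%:R)) <= 2^-1.
Proof.
move=> eps0 /andP[c0 c1] ceps x0 l1 lx n_gt0 ns; set l : R := ln d%:R in l1 lx ns *.
have d0 : 0 < d%:R :> R.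
  rewrite ltr0n lt0n; apply/negP => /eqP d0.
  by move: l1; rewrite /l d0 ln0 // ler10.
have n0 : 0 < n%:R :> R by rewrite ltr0n.
have n1 : 1 <= n%:R :> R by rewrite ler1n.
have ld : expR l = d%:R by rewrite lnK.
have sd : (2 + eps) * l * n%:R <= (s * d)%:R.
  by rewrite natrM -ler_pdivrMr //; apply: le_trans ns; rewrite le_eqVlt; apply/orP; left; apply/eqP; ring.
have l0 : 0 < l by apply: lt_le_trans l1.
have nsd : n%:R <= (s * d)%:R :> R by apply: le_trans sd; rewrite ler_peMl ?(ltW n0) //; nra.
have s0 : 0 < s%:R :> R.
  by have := lt_le_trans n0 nsd; rewrite natrM pmulr_lgt0.
have h1 : n%:R / s%:R <= expR l by rewrite ld ler_pdivrMr // mulrC -natrM.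
have h2 : expR (- (c * ((s * d)%:R - 1) / n.*2%:R)) <= expR (1 - (1 + eps / 4) * l).
  rewrite ler_expR lerNl opprB.
  have n2 : 0 < n.*2%:R :> R by rewrite ltr0n double_gt0.
  rewrite ler_pdivlMr // -mul2n natrM -ceps.
  have := ler_wpM2l c0 sd; nra.
have ex0 : 0 <= expR 1 / x by rewrite divr_ge0 ?expR_ge0 // ltW.
apply: (@le_trans _ _ (expR l * (expR 1 / x) * expR (1 - (1 + eps / 4) * l))).
  apply: ler_pM h2; rewrite ?expR_ge0 //; last exact: ler_wpM2r.
  by rewrite mulr_ge0 // divr_ge0.
have -> : expR l * (expR 1 / x) * expR (1 - (1 + eps / 4) * l) =
    (expR 2 / x) * expR (- (eps / 4 * l)).
  rewrite mulrA -expRD [LHS]mulrAC -expRD mulrAC -expRD; congr (expR _ / x); ring.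
have q0 : 0 < 2 * expR 2 / x by rewrite divr_gt0 // mulr_gt0 ?expR_gt0.
rewrite expRN ler_pdivrMr ?expR_gt0 // -[leRHS]mulrC ler_pdivlMr //.
apply: (@le_trans _ _ (expR (ln (2 * expR 2 / x)))).
  by rewrite lnK ?posrE // le_eqVlt; apply/orP; left; apply/eqP; ring.
rewrite ler_expR; apply: le_trans (ler_wpM2l _ lx); last by rewrite divr_ge0 // ltW.
by rewrite le_eqVlt; apply/orP; left; apply/eqP; field; rewrite lt0r_neq0.
Qed.

(** From e^l = (e^(l / 2))^2 >= (l / 2)^2. *)
Lemma ln_div_le (d : nat) : 0 < ln d%:R :> R -> ln d%:R / d%:R <= 4 / ln d%:R :> R.
Proof.
move=> l0; set l : R := ln d%:R in l0 *.
have d0 : 0 < d%:R :> R.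
  rewrite ltr0n lt0n; apply/negP => /eqP d0.
  by move: l0; rewrite /l d0 ln0 // ltxx.
have ld : expR l = d%:R by rewrite lnK.
rewrite ler_pdivrMr // mulrAC ler_pdivlMr // -ld.
have -> : expR l = expR (l / 2) * expR (l / 2) by rewrite -expRD; congr expR; field.
have := @expR_ge1Dx R (l / 2); nra.
Qed.

(** Outside the two exceptional events every percolation set has density at most
    [b]: a denser one would contain a percolation set of exactly s vertices,
    which by [inner_percolation] spans at most s edges.  The second event has
    probability at most 2 ^ -s <= 1 / s <= 1 / (b n). *)
Lemma prob_config_ge (b : R) (tau d n : nat) :
  (0 < d)%N -> ~~ odd (n * d) -> (4 <= n)%N -> (4 * tau <= n)%N -> 0 < b <= 4^-1 ->
  (forall s, (0 < s)%N -> (s.*2 <= n)%N -> b * n%:R <= s%:R ->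
   #|[set M : pairing (half_edge n d) |
     [exists S in [pred S : {set 'I_n} | #|S| == s],
       (inner (pairs M) (emitted d S) <= s)%N]]%SET|%:R
    <= #|{: pairing (half_edge n d)}|%:R * 2^-1 ^+ s :> R) ->
  1 - (expR 1 * (1 + 2 * tau%:R) ^+ (tau * d) + b^-1) / n%:R
   <= prob_config R n d (fun G => alpha R tau G <= b) <= 1.
Proof.
move=> d_gt0 nd n4 taun /andP[b0 b4] sparse.
have n_gt0 : (0 < n)%N by lia.
have n0 : 0 < n%:R :> R by rewrite ltr0n.
have Ek : (n * d)%N = (n * d)./2.*2 by rewrite even_halfK.
have T0 := card_pairing_gt0 R Ek.
rewrite /prob_config; set T : R := #|{: pairing _}|%:R in T0 *.
set good := [set M | _]%SET.
apply/andP; split; last by rewrite ler_pdivrMr // mul1r ler_nat max_card.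
have bn0 : 0 <= b * n%:R by rewrite mulr_ge0 // ltW.
pose s := (Num.truncn (b * n%:R)).+1.
have /andP[s_lo s_hi] := truncn_itv bn0.
have sn : (s.*2 <= n)%N.
  have : 4 * (Num.truncn (b * n%:R))%:R <= n%:R :> R by nra.
  by rewrite -natrM ler_nat /s; lia.
have bs : b * n%:R <= s%:R by apply: ltW.
have bad1 := card_dense_small R n_gt0 d_gt0 Ek taun; rewrite -/T in bad1.
have bad2 := sparse s isT sn bs; rewrite -/T in bad2.
set B1 := [set M | _]%SET in bad1; set B2 := [set M | _]%SET in bad2.
have bad : ~: good \subset B1 :|: B2.
  apply/fintype.subsetP => M; rewrite !inE -ltNge => alpha_gt.
  rewrite -implyNb; apply/implyP => dense.
  have {}dense (U : {set 'I_n}) : (#|U| <= tau)%N -> (inner (pairs M) (emitted d U) <= #|U|)%N.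
    move=> Utau; rewrite leqNgt; apply: contra dense => UM.
    by apply/exists_inP; exists U.
  have [S percS Sb] : exists2 S : {set 'I_n}, percolation_set (G := config_multigraph M) tau S
      & b < #|S|%:R / n%:R.
    apply/not_exists2P => alpha_le; move: alpha_gt; apply/negP; rewrite -leNgt.
    apply: bigmax_le => [|S percS]; first exact: ltW.
    rewrite [#|vertex _|]card_ord.
    by have [/(_ percS)//|/negP] := alpha_le S; rewrite -leNgt.
  have sS : (s <= #|S|)%N.
    by rewrite /s truncn_lt_nat // -ltr_pdivlMr.
  have [S' S'S S's] := subset_of_card sS.
  apply/exists_inP; exists S'; first by rewrite inE S's.
  by rewrite -S's; apply: inner_percolation dense _; exact: (@percolation_sub (config_multigraph M) _ _ _ S'S percS).
have cards : T <= #|good|%:R + (#|B1|%:R + #|B2|%:R).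
  rewrite -!natrD ler_nat -(cardsC good) leq_add2l.
  by apply: leq_trans (subset_leq_card bad) _; rewrite leq_card_setU.
have half_s : 2^-1 ^+ s <= (b * n%:R)^-1 :> R.
  rewrite exprVn lef_pV2 ?posrE ?exprn_gt0 ?mulr_gt0 //; apply: le_trans bs _.
  by rewrite -natrX ler_nat ltnW // ltn_expl.
rewrite ler_pdivlMr //; set C := expR 1 * _.
have -> : (1 - (C + b^-1) / n%:R) * T = T - (T * (C / n%:R) + T * (b * n%:R)^-1).
  by rewrite invfM; ring.
rewrite lerBlDr; apply: le_trans cards _; rewrite lerD2l lerD //.
by apply: le_trans bad2 _; rewrite ler_wpM2l // ltW.
Qed.

End Asymptotics.

Local Open Scope classical_set_scope.
Local Open Scope ring_scope.

Theorem corollary1p1 (R : realType) (eps : R) (eps_gt0 : 0 < eps) :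
  exists d0 : nat, forall tau d : nat, (1 <= tau)%N -> (d0 <= d)%N ->
    prob_config R n d
      (fun G => alpha R tau G <= (2 + eps) * (ln d%:R / d%:R))
      @[n --> within [set n : nat | ~~ odd (n * d)] \oo] --> (1 : R).
Proof.
pose c : R := (1 + eps / 4) / (1 + eps / 2).
have ceps : c * (1 + eps / 2) = 1 + eps / 4 by rewrite /c divfK // lt0r_neq0 //; lra.
have c0 : 0 <= c by nra.
have c1 : c < 1 by nra.
pose x : R := (1 - c) / 2.
have x0 : 0 < x by rewrite divr_gt0 ?subr_gt0.
(* The summands of [L] ensure ln d >= 1, then that the base of the first-moment
   bound is at most 1 / 2, and that b <= 1 / 4. *)
pose L : R := 1 + `|4 / eps * ln (2 * expR 2 / x)| + 16 * (2 + eps).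
have eps2 : 0 < 16 * (2 + eps) by lra.
exists (Num.truncn (expR L)).+1 => tau d tau1 dL.
have L0 : 0 < L by rewrite /L addr_gt0 // ltr_wpDr.
have /andP[_ Ld] := truncn_itv (expR_ge0 L).
have {Ld} dL : expR L <= d%:R by apply: le_trans (ltW Ld) _; rewrite ler_nat.
have d0 : 0 < d%:R :> R by apply: lt_le_trans dL; apply: expR_gt0.
have d_gt0 : (0 < d)%N by rewrite -(ltr0n R).
set l : R := ln d%:R.
have lL : L <= l by rewrite -ler_expR lnK.
have l_ge1 : 1 <= l by apply: le_trans lL; rewrite /L -addrA lerDl addr_ge0 // ltW.
have l_gt0 : 0 < l by apply: lt_le_trans l_ge1.
have lx : 4 / eps * ln (2 * expR 2 / x) <= l.
  apply: le_trans (ler_norm _) _; apply: le_trans lL.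
  by rewrite /L -addrA addrCA lerDl addr_ge0 // ltW.
have l16 : 16 * (2 + eps) <= l by apply: le_trans lL; rewrite /L lerDr.
set b := (2 + eps) * (l / d%:R).
have b0 : 0 < b by rewrite mulr_gt0 ?divr_gt0 //; lra.
have b4 : b <= 4^-1.
  apply: (@le_trans _ _ ((2 + eps) * (4 / l))).
    by apply: ler_wpM2l; [lra|exact: ln_div_le].
  by rewrite mulrA ler_pdivrMr //; lra.
set C := expR 1 * (1 + 2 * tau%:R) ^+ (tau * d) + b^-1.
have C0 : 0 < C.
  by rewrite addr_gt0 ?invr_gt0 // mulr_gt0 ?expR_gt0 // exprn_gt0 // ltr_wpDr // mulr_ge0.
have bounds n : (4 <= n)%N -> (4 * tau <= n)%N -> ~~ odd (n * d) ->
    1 - C / n%:R <= prob_config R n d (fun G => alpha R tau G <= b) <= 1.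
  move=> n4 taun nd; apply: prob_config_ge => //; first by rewrite b0.
  move=> s s_gt0 sn bs.
  have Ek : (n * d)%N = (n * d)./2.*2 by rewrite even_halfK.
  have n_gt0 : (0 < n)%N := leq_ltn_trans (leq0n 3) n4.
  apply: le_trans (card_sparse_large n_gt0 d_gt0 Ek x0 c0 _ s_gt0 sn) _.
    by rewrite /x divfK.
  rewrite ler_wpM2l // lerXn2r ?nnegrE ?invr_ge0 //.
    by rewrite !mulr_ge0 ?expR_ge0 ?invr_ge0 // ltW.
  by apply: (first_moment_base eps_gt0) => //; rewrite c0 ltW.
apply/cvgrPdist_le => e e0; rewrite near_withinE.
exists (maxn (Num.truncn (C / e)).+1 (maxn (4 * tau) 4)) => // n /= + nd.
rewrite !geq_max => /and3P[n_large taun n4].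
have /andP[lo hi] : 1 - C / n%:R <= prob_config R n d (fun G => alpha R tau G <= b) <= 1.
  exact: bounds nd.
have n_gt0 : 0 < n%:R :> R by rewrite ltr0n (leq_trans _ n4).
rewrite ger0_norm ?subr_ge0 //; apply: (@le_trans _ _ (C / n%:R)); first by lra.
rewrite ler_pdivrMr // mulrC -ler_pdivrMr //.
have /andP[_ /ltW Ce] := truncn_itv (ltW (divr_gt0 C0 e0)).
by apply: le_trans Ce _; rewrite ler_nat.
Qed.
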